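(* Let $V$ be an open neighborhood of $0$ in $\mathbb{R}^2$ (with coordinates $(x,y)$), endowed with the standard area form $\omega_0=dx\wedge dy$. Let $F_0,G_0\in C^\infty(\overline V)$ and suppose that $\{F_0,G_0\}(0)=1$. Then for any $\varepsilon>0$ there exist $\delta>0$ and an open neighborhood $U\subset V$ of $0$ such that for all $F,G\in C^\infty(\overline V)$ satisfying $\|F-F_0\|_{\overline V}<\delta$ and $\|G-G_0\|_{\overline V}<\delta$ there exists $z\in U$ with $\{F,G\}(z)>1-\varepsilon$.
   Context: $\|\cdot\|_{\overline V}$ denotes the supremum norm over the closure $\overline V$. $C^\infty(\overline V)$ denotes the real-valued functions smooth on $\overline V$ (up to the boundary). The Poisson bracket is determined by the sign convention $-dF\wedge dG=\{F,G\}\,\omega_0$. *)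

(* Defs.v *)
From HB Require Import structures.
From mathcomp Require Import all_boot all_order all_algebra.
From mathcomp Require Import all_classical all_reals all_analysis.
From mathcomp Require Import ring.

Set Implicit Arguments.
Unset Strict Implicit.
Unset Printing Implicit Defensive.

Import Order.TTheory GRing.Theory Num.Theory.
Import numFieldNormedType.Exports.

Local Open Scope classical_set_scope.
Local Open Scope ring_scope.

(* The coordinate directions of the plane: [false] is x and [true] is y. *)
Definition axis (R : realType) (i : bool) : R * R :=
  if i then (0, 1) else (1, 0).

Definition partial (R : realType) (i : bool) (F : R * R -> R) : R * R -> R :=
  fun z => 'D_(axis R i) F z.

Definition partials (R : realType) (s : seq bool) (F : R * R -> R) :
    R * R -> R :=
  foldr (@partial R) F s.

Definition smooth_on (R : realType) (V : set (R * R)) (F : R * R -> R) : Prop :=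
  forall (s : seq bool) (z : R * R), V z ->
    {for z, continuous (partials s F)} /\
    (forall i : bool, derivable (partials s F) z (axis R i)).

(* C^oo of the closure of an open set V: F is smooth on V, and F and all its
   partial derivatives extend continuously from V to the closure, F itself
   being the extension at order 0. Functions are total, but only the values on
   the closure of V matter. *)
Definition smooth_closure (R : realType) (V : set (R * R)) (F : R * R -> R) :
    Prop :=
  [/\ smooth_on V F,
      {within closure V, continuous F} &
      forall s : seq bool, exists2 g : R * R -> R,
        {within closure V, continuous g} &
        forall z, V z -> g z = partials s F z].

(* Valued in the extended reals, since V need not be bounded. *)
Definition supnorm (R : realType) (A : set (R * R)) (f : R * R -> R) : \bar R :=
  ereal_sup [set `|f z|%:E | z in A].

Definition wedge (R : realType) (a b : R * R -> R) (u v : R * R) : R :=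
  a u * b v - a v * b u.

(* The area form dx /\ dy. *)
Definition omega0 (R : realType) : R * R -> R * R -> R :=
  wedge (@fst R R) (@snd R R).

(* Sign convention: - dF /\ dG = {F, G} omega0; see [poissonE]. *)
Definition poisson (R : realType) (F G : R * R -> R) (z : R * R) : R :=
  - (partial false F z * partial true G z
     - partial true F z * partial false G z).

Lemma poissonE (R : realType) (F G : R * R -> R) (z u v : R * R) :
  differentiable F z -> differentiable G z ->
  - wedge ('d F z) ('d G z) u v = poisson F G z * omega0 u v.
Proof.
move=> dF dG.
have E (H : R * R -> R) (w : R * R) : differentiable H z ->
    'd H z w = w.1 * partial false H z + w.2 * partial true H z.
  move=> dH; rewrite /partial !deriveE //=.
  have -> : 'd H z w = 'd H z (w.1 *: (1, 0) + w.2 *: (0, 1)).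
    congr ('d H z _); case: w => a b.
    by congr pair; rewrite /= /GRing.scale /= !(mulr1, mulr0) ?addr0 ?add0r.
  by rewrite linearD !linearZ.
rewrite /wedge /omega0 /wedge /poisson !E //.
ring.
Qed.

(* Main.v *)
Require Import Defs.
From HB Require Import structures.
From mathcomp Require Import all_boot all_order all_algebra.
From mathcomp Require Import all_classical all_reals all_analysis.
From mathcomp Require Import ring lra.

Set Implicit Arguments.
Unset Strict Implicit.
Unset Printing Implicit Defensive.

Import Order.TTheory GRing.Theory Num.Theory.
Import numFieldNormedType.Exports.

Local Open Scope classical_set_scope.
Local Open Scope ring_scope.

(* Let [a1], [a2] be nonnegative bumps around [F0(0)], [G0(0)] so narrow that
   [a1(F0) a2(G0)], hence also [a1(F) a2(G)], vanishes on the boundary of a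
   small square. Compose with primitives: [A1(F)] and [A2(G)] have Jacobian
   [- a1(F) a2(G) {F, G}], whose integral over the square is the same for
   [(F, G)] and [(F0, G0)], because the difference is the differential of a
   1-form vanishing on the boundary (a smooth form of degree theory). If
   [{F, G} <= 1 - eps] everywhere, positivity of the bumps gives
   [int a1(F0) a2(G0) {F0, G0} <= (1 - eps) int a1(F) a2(G)], which contradicts
   [{F0, G0} > 1 - eps / 2], since [a1(F) a2(G)] is uniformly close to
   [a1(F0) a2(G0)].
   No integral is needed: a vector field vanishing on the boundary of a square
   has a point of nonnegative divergence, and adding an explicit field whose
   divergence is negative off a neighborhood of 0 turns the comparison of
   integrals into a pointwise contradiction. *)

(** * One-variable calculus: clamping and polynomial bumps *)

(** At [y = x] the inequality is trivial, so the punctured neighborhood of the definition becomes a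
    full one, and the estimate can be pulled back along a continuous map. *)
Lemma is_derive0P (R : realType) (f : R -> R) (x : R) :
  is_derive x 1 f 0 <->
  forall e, 0 < e -> \forall y \near x, `|f y - f x| <= e * `|y - x|.
Proof.
have E : is_derive x 1 f 0 <->
    (h^-1 *: ((f \o shift x) (h *: 1) - f x) @[h --> 0^'] --> (0 : R)).
  split=> [[df dfE]|df]; first by rewrite -[X in _ --> X]dfE; exact: df.
  by apply: DeriveDef; [apply/cvg_ex; exists 0 | exact: cvg_lim].
rewrite E; split=> [/cvgrPdist_le df e e0|df].
  have := df _ e0; rewrite /dnbhs /within /= => /nbhs_ballP[d /= d0 dP].
  apply/nbhs_ballP; exists d => //= y yd.
  have [->|yx] := eqVneq y x; first by rewrite !subrr normr0 mulr0.
  have yx0 : y - x != 0 by rewrite subr_eq0.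
  have := dP (y - x); rewrite /ball/= !sub0r !normrN distrC => /(_ yd yx0).
  rewrite /shift /= /GRing.scale /= mulr1 subrK normrM normfV.
  by rewrite ler_pdivrMl ?normr_gt0 // mulrC (distrC x).
apply/cvgrPdist_le => e e0; rewrite /dnbhs /within /=.
have /nbhs_ballP[d /= d0 dP] := df _ e0.
apply/nbhs_ballP; exists d => //= h; rewrite /ball /= sub0r normrN => hd h0.
have := dP (h + x); rewrite /ball /= opprD addrC addrNK normrN => /(_ hd).
rewrite addrK /shift /= sub0r normrN /GRing.scale /= mulr1 normrM normfV.
by rewrite ler_pdivrMl ?normr_gt0 // mulrC.
Qed.

(** Composition with [clamp] extends a function from [-1, 1] by its end values, without any
    gluing. *)
Definition clamp (R : realType) (x : R) : R := Num.max (-1) (Num.min 1 x).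

Lemma clamp_dist (R : realType) (x y : R) : `|clamp x - clamp y| <= `|x - y|.
Proof.
have := ler_norm (x - y); have := ler_norm (y - x); rewrite (distrC y x).
rewrite /clamp ler_norml /Order.max /Order.min.
case: (ltP 1 x) => ?; case: (ltP 1 y) => ?; case: (ltP (-1 : R) 1) => ?;
case: (ltP (-1) x) => ?; case: (ltP (-1) y) => ? ? ?; apply/andP; split; lra.
Qed.

Lemma clamp_id (R : realType) (x : R) : -1 <= x <= 1 -> clamp x = x.
Proof. by case/andP=> h1 h2; rewrite /clamp (min_idPr h2) (max_idPr h1). Qed.

Lemma clamp_ge1 (R : realType) (x : R) : 1 <= x -> clamp x = 1.
Proof. by move=> h; rewrite /clamp (min_idPl h) max_r//; lra. Qed.

Lemma clamp_leN1 (R : realType) (x : R) : x <= -1 -> clamp x = -1.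
Proof. by move=> h; rewrite /clamp min_r ?max_l//; lra. Qed.

Lemma clamp_itv (R : realType) (x : R) : -1 <= clamp x <= 1.
Proof. by rewrite /clamp le_max lexx /= ge_max ge_min lexx /= andbT; lra. Qed.

Lemma clamp_continuous (R : realType) : continuous (@clamp R).
Proof.
move=> x; apply/cvgrPdist_le => e e0; near=> y.
apply: (le_trans (clamp_dist _ _)); near: y.
by apply: cvgr_dist_le.
Unshelve. all: by end_near. Qed.

(** In the open interval [clamp] is locally the identity. Elsewhere [clamp x] is an end point,
    critical for [p], and the little-o estimate there passes to [x] because [clamp] is
    1-Lipschitz. *)
Lemma is_derive_clamp (R : realType) (p dp : R -> R) (x : R) :
  (forall y : R, is_derive y 1 p (dp y)) -> dp 1 = 0 -> dp (-1) = 0 ->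
  is_derive x 1 (p \o @clamp R) (dp (clamp x)).
Proof.
move=> pdp dp1 dpN1.
have [/andP[x1 x2]|] := boolP (-1 < x < 1).
  rewrite clamp_id; last by rewrite !ltW.
  apply: near_eq_is_derive (pdp x); near=> y => /=.
  rewrite clamp_id //; apply/andP; split; near: y.
    exact: lt_le_nbhsr.
  exact: lt_le_nbhsl.
move=> xN.
have E : dp (clamp x) = 0.
  move: xN; rewrite negb_and -!leNgt => /orP[] h.
    by rewrite clamp_leN1.
  by rewrite clamp_ge1.
rewrite E; apply/is_derive0P => e e0.
have := pdp (clamp x); rewrite E => /is_derive0P/(_ _ e0) H.
have Hx : \forall y \near x, `|p (clamp y) - p (clamp x)|
    <= e * `|clamp y - clamp x| := @clamp_continuous R x _ H.
near=> y; apply: le_trans (_ : e * `|clamp y - clamp x| <= _).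
  by near: y.
by rewrite ler_pM2l // clamp_dist.
Unshelve. all: by end_near. Qed.

Lemma is_derive_continuous (R : realType) (f : R -> R) (x df : R) :
  is_derive x 1 f df -> {for x, continuous f}.
Proof.
by case=> /derivable1_diffP df_ _; exact: differentiable_continuous.
Qed.

(* [8 / 15] is the integral of [(1 - x ^ 2) ^ 2] over [0, 1]: the bump is this
   polynomial rescaled to the interval of radius [c] around [w]. *)
Record bump (R : realType) (w c : R) (A a b : R -> R) : Prop := Bump {
  bump_primitive : forall u : R, is_derive u 1 A (a u);
  bump_derive : forall u : R, is_derive u 1 a (b u);
  bump_derive_cont : continuous b;
  bump_itv : forall u, 0 <= a u <= 1;
  bump_out : forall u, c <= `|u - w| -> a u = 0;
  bump_in : forall u, `|u - w| <= c / 2 -> 1 / 2 <= a u;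
  bump_lip : forall u v, `|a u - a v| <= 4 / c * `|u - v|;
  bump_right : forall u, w + c <= u -> A u = 8 / 15 * c;
  bump_left : forall u, u <= w - c -> A u = - (8 / 15 * c) }.

(** Both [q] and [q'] vanish at 1 and -1, so the primitive [p] and [q] itself stay differentiable
    when clamped. The affine map [m] carries the interval of radius [c] around [w] to [-1, 1]. *)
Lemma bump_exists (R : realType) (w c : R) : 0 < c ->
  exists A a b, @bump R w c A a b.
Proof.
move=> c0.
pose p (x : R) := x - 2 / 3 * x ^+ 3 + 1 / 5 * x ^+ 5.
pose q (x : R) := (1 - x ^+ 2) ^+ 2.
pose q' (x : R) := - 4 * x * (1 - x ^+ 2).
pose m (u : R) := (u - w) / c.
have mD (u : R) : is_derive u 1 m c^-1.
  rewrite /m; apply: is_derive_eq; rewrite /GRing.scale /=; ring.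
have pD (x : R) : is_derive x 1 p (q x).
  rewrite /p /q; apply: is_derive_eq; rewrite /GRing.scale /=; by field.
have qD (x : R) : is_derive x 1 q (q' x).
  rewrite /q /q'; apply: is_derive_eq; rewrite /GRing.scale /=; ring.
have pcD (x : R) : is_derive x 1 (p \o @clamp R) (q (clamp x)).
  by apply: is_derive_clamp; rewrite // /q; ring.
have qcD (x : R) : is_derive x 1 (q \o @clamp R) (q' (clamp x)).
  by apply: is_derive_clamp; rewrite // /q'; ring.
have cl x := @clamp_itv R x.
have m_out u : c <= `|u - w| -> 1 <= m u \/ m u <= -1.
  rewrite /m ler_pdivlMr // ler_pdivrMr // mul1r mulN1r.
  by rewrite ler_normr => /orP[]; [left | right; lra].
exists (fun u => c * p (clamp (m u))), (fun u => q (clamp (m u))),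
  (fun u => q' (clamp (m u)) / c); split=> /=.
- move=> u; have D := is_derive1_comp (pcD (m u)) (mD u).
  have -> : (fun u => c * p (clamp (m u))) = c \*: ((p \o @clamp R) \o m).
    by [].
  apply: is_derive_eq; rewrite /GRing.scale /=; field; lra.
- by move=> u; exact: is_derive1_comp (qcD (m u)) (mD u).
- move=> u; apply: cvgM; last exact: cvg_cst.
  apply: (@continuous_comp _ _ _ m (q' \o @clamp R)).
    exact: is_derive_continuous (mD u).
  apply: continuous_comp; first exact: clamp_continuous.
  have : is_derive (clamp (m u)) 1 q' (12 * clamp (m u) ^+ 2 - 4).
    rewrite /q'; apply: is_derive_eq; rewrite /GRing.scale /=; ring.
  exact: is_derive_continuous.
- move=> u; rewrite /q; have /andP[h1 h2] := cl (m u).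
  have : clamp (m u) ^+ 2 <= 1 by nra.
  have := sqr_ge0 (clamp (m u)); move: (clamp _ ^+ 2) => t t0 t1.
  by rewrite sqr_ge0 expr_le1 //; lra.
- move=> u /m_out[] h; rewrite /q ?(clamp_ge1 h) ?(clamp_leN1 h); ring.
- move=> u; rewrite ler_norml => /andP[h1 h2].
  have h3 : -1 / 2 <= m u by rewrite /m ler_pdivlMr //; lra.
  have h4 : m u <= 1 / 2 by rewrite /m ler_pdivrMr //; lra.
  rewrite clamp_id; last by lra.
  (* Hence [q] is at least (1 - 1 / 4) ^ 2 = 9 / 16 here. *)
  have : m u ^+ 2 <= 1 / 4 by nra.
  rewrite /q; nra.
- move=> u v.
  have -> : 4 / c * `|u - v| = 4 * `|m u - m v|.
    rewrite /m -mulrBl normrM normfV (gtr0_norm c0) opprB addrA subrK.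
    ring.
  apply: le_trans (_ : 4 * `|clamp (m u) - clamp (m v)| <= _); last first.
    by rewrite ler_pM2l // clamp_dist.
  move: (clamp (m u)) (clamp (m v)) (cl (m u)) (cl (m v)) => s t.
  move=> /andP[s1 s2] /andP[t1 t2].
  (* On [-1, 1] each of the first two factors has absolute value at most 2. *)
  have -> : q s - q t = ((s + t) * (s ^+ 2 + t ^+ 2 - 2)) * (s - t).
    rewrite /q; ring.
  have -> : 4 = 2 * 2 :> R by ring.
  rewrite normrM ler_wpM2r // normrM ler_pM //.
    by rewrite ler_norml; lra.
  by rewrite ler_norml; apply/andP; split; nra.
- move=> u hu; rewrite clamp_ge1 /p; first by field.
  by rewrite /m ler_pdivlMr //; lra.
- move=> u hu; rewrite clamp_leN1 /p; first by field.
  by rewrite /m ler_pdivrMr //; lra.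
Qed.

(** * Divergence of a planar field on a square *)

Definition coord (R : realType) (i : bool) (z : R * R) : R :=
  if i then z.2 else z.1.

Definition line (R : realType) (i : bool) (z : R * R) (t : R) : R * R :=
  if i then (z.1, t) else (t, z.2).

(** Stated along a coordinate line, so that Rolle, the mean value theorem and the chain rule of one
    variable apply directly. *)
Definition is_pderiv (R : realType) (i : bool) (F : R * R -> R) (z : R * R)
    (l : R) : Prop :=
  is_derive (coord i z) 1 (F \o line i z) l.

Definition square (R : realType) (r : R) : set (R * R) :=
  [set z | `|z.1| <= r /\ `|z.2| <= r].

Lemma square_compact (R : realType) (r : R) : compact (square r).
Proof.
have -> : square r = `[- r, r] `*` `[- r, r].
  by apply/seteqP; split=> [[x y]|[x y]];
    rewrite /square /= !in_itv /= !ler_norml.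
by apply: compact_setX; exact: segment_compact.
Qed.

(** In a grid cell the mean value theorem displaces the argument of [f] but not that of [g].
    Compactness, in its near-covering form, makes the admissible displacement uniform. *)
Lemma uniform_sum_lt0 (R : realType) (K : set (R * R)) (f g : R * R -> R) :
  compact K -> (forall z, K z -> {for z, continuous f}) ->
  (forall z, K z -> {for z, continuous g}) ->
  (forall z, K z -> f z + g z < 0) ->
  exists2 d, 0 < d & forall z, K z -> forall x, `|x - z.1| <= d ->
    f (x, z.2) + g z < 0.
Proof.
move=> cK fc gc fg.
have /compact_near_coveringP nK := cK.
have := nK R 0^'+
  (fun d z => forall x, `|x - z.1| <= d -> f (x, z.2) + g z < 0).
case=> [z Kz|e /= e0 He].
(* Half of the gap below 0: [f] and [g] may each move by less than this. *)
- pose e := - (f z + g z) / 2.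
  have e0 : 0 < e by rewrite divr_gt0 // oppr_gt0 fg.
  have /cvgr_dist_lt/(_ _ e0)/nbhs_ballP[d1 /= d10 H1] := fc z Kz.
  have /cvgr_dist_lt/(_ _ e0)/nbhs_ballP[d2 /= d20 H2] := gc z Kz.
  pose d := Num.min d1 d2.
  have d0 : 0 < d by rewrite lt_min d10.
  have dd1 : d <= d1 by rewrite ge_min lexx.
  have dd2 : d <= d2 by rewrite ge_min lexx orbT.
  exists (ball z (d / 2), [set t : R | t < d / 2]) => /=.
    split; first by apply: nbhsx_ballx; rewrite divr_gt0.
    by apply: nbhs_right_lt; rewrite divr_gt0.
  move=> [w t] /= [[]]; rewrite /ball /= => w1 w2 td x xt.
  have /H1 : ball z d1 (x, w.2).
    split; rewrite /ball /=; last by lra.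
    have -> : z.1 - x = (z.1 - w.1) - (x - w.1) by ring.
    by apply: le_lt_trans (ler_normB _ _) _; lra.
  have /H2 : ball z d2 w by split; rewrite /ball /=; lra.
  have := ler_norm (f (x, w.2) - f z); have := ler_norm (g w - g z).
  rewrite (distrC _ (f z)) (distrC _ (g z)) /= /e; lra.
- exists (e / 2); first by rewrite divr_gt0.
  move=> z Kz x; apply: He => //=; last by rewrite divr_gt0.
  by rewrite sub0r normrN gtr0_norm ?divr_gt0 //; lra.
Qed.

Lemma mvt_le (R : realType) (f df : R -> R) (a b : R) : a <= b ->
  (forall x, a <= x <= b -> is_derive x 1 f (df x)) ->
  exists2 c, a <= c <= b & f b - f a = df c * (b - a).
Proof.
move=> ab D.
have [x xab||c] := @MVT_segment R f df a b ab.
- by apply: D; move: (subset_itv_oo_cc xab); rewrite in_itv.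
- by apply: derivable_within_continuous => x; rewrite in_itv /= => /D[].
- by rewrite in_itv /= => cab E; exists c.
Qed.

Lemma mvt_dist (R : realType) (f df : R -> R) (a b : R) :
  (forall x, `|x - a| <= `|b - a| -> is_derive x 1 f (df x)) ->
  exists2 c, `|c - a| <= `|b - a| & f b - f a = df c * (b - a).
Proof.
move=> D; have [ab|/ltW ba] := leP a b.
  have [x xab|c cab E] := @mvt_le R f df a b ab.
    by apply: D; rewrite !ger0_norm; lra.
  by exists c => //; rewrite !ger0_norm; lra.
have [x xab|c cab E] := @mvt_le R f df b a ba.
  by apply: D; rewrite !ler0_norm; lra.
exists c; first by rewrite !ler0_norm; lra.
by rewrite -opprB E; ring.
Qed.

(* A discrete divergence theorem: sum [P] over a fine grid in x and apply
   Rolle in y, so that the [Py] sum to zero on some horizontal line; on that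
   line [Q] telescopes to zero through the mean value theorem. *)
Lemma divergence_ge0 (R : realType) (r : R) (P Q Py Qx : R * R -> R) :
  0 < r ->
  (forall z, square r z -> is_pderiv false Q z (Qx z)) ->
  (forall z, square r z -> is_pderiv true P z (Py z)) ->
  (forall z, square r z -> {for z, continuous Qx}) ->
  (forall z, square r z -> {for z, continuous Py}) ->
  (forall z, square r z -> `|z.1| = r -> Q z = 0) ->
  (forall z, square r z -> `|z.2| = r -> P z = 0) ->
  exists2 z, square r z & 0 <= Qx z + Py z.
Proof.
move=> r0 QD PD Qc Pc Q0 P0; apply: contrapT => noz.
have neg z : square r z -> Qx z + Py z < 0.
  by move=> sz; rewrite ltNge; apply/negP => h; apply: noz; exists z.
have [d d0 Hd] := uniform_sum_lt0 (@square_compact R r) Qc Pc neg.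
(* Enough cells for the mesh [h] to be at most [d]. *)
pose N := (Num.truncn (2 * r / d)).+1.
pose h := 2 * r / N%:R.
have N0 : 0 < N%:R :> R by rewrite ltr0n.
have h0 : 0 < h by rewrite divr_gt0 // mulr_gt0.
have hd : h <= d.
  rewrite /h ler_pdivrMr // -ler_pdivrMl // mulrC.
  by apply: ltW; rewrite truncnS_gt.
pose X (i : nat) := - r + i%:R * h.
have X0 : X 0%N = - r by rewrite /X mul0r addr0.
have XN : X N = r by rewrite /X /h; field; rewrite gt_eqF.
have XS i : X i.+1 = X i + h by rewrite /X -natr1; ring.
have Xin i : (i <= N)%N -> `|X i| <= r.
  move=> iN; rewrite -[leRHS]XN ler_norml.
  have : i%:R * h <= N%:R * h by rewrite ler_pM2r // ler_nat.
  have : 0 <= i%:R * h by rewrite mulr_ge0 // ltW.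
  by move: XN; rewrite /X; lra.
pose I := \sum_(i < N) (fun y => P (X i, y)).
have IE y : I y = \sum_(i < N) P (X i, y) by rewrite /I fct_sumE.
have ID (y : R) : `|y| <= r -> is_derive y 1 I (\sum_(i < N) Py (X i, y)).
  move=> yr; apply: is_derive_sum => i.
  by apply: (PD (X i, y)); split => //=; rewrite Xin // ltnW.
have Ib y : `|y| = r -> I y = 0.
  move=> yr; rewrite IE big1 // => i _; apply: P0 => //.
  by split => /=; rewrite ?yr // Xin // ltnW.
have rN : - r < r by lra.
have [y0 y0r Iy0] : exists2 y0, `|y0| <= r & \sum_(i < N) Py (X i, y0) = 0.
  have [||| y] := @Rolle R I _ _ rN.
  - move=> y; rewrite in_itv /= => /andP[y1 y2].
    by case: (ID y) => //; rewrite ler_norml; lra.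
  - apply: derivable_within_continuous => y; rewrite in_itv /= -ler_norml.
    by move=> /ID[].
  - by rewrite !Ib // ?normrN gtr0_norm.
  rewrite in_itv /= => /andP[y1 y2] yD.
  exists y; first by rewrite ler_norml; lra.
  have yr : `|y| <= r by rewrite ler_norml; lra.
  by have [_ <-] := ID y yr; case: yD.
have Qi (i : 'I_N) : exists2 x, `|x - X i| <= h &
    Q (X i.+1, y0) - Q (X i, y0) = Qx (x, y0) * h.
  have XX : X i <= X i.+1 by rewrite XS lerDl ltW.
  have [x /andP[x1 x2]|x /andP[x1 x2] xE] :=
      @mvt_le R (fun x => Q (x, y0)) (fun x => Qx (x, y0)) (X i) (X i.+1) XX.
    apply: (QD (x, y0)); split => //=; have := @Xin i; have := @Xin i.+1.
    rewrite !ler_norml ltn_ord.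
    by move=> /(_ isT) ? /(_ (ltnW (ltn_ord i))) ?; lra.
  exists x; first by rewrite XS in x2; rewrite ger0_norm; lra.
  by rewrite xE XS; congr (_ * _); ring.
pose xiP i x := `|x - X i| <= h /\
  Q (X i.+1, y0) - Q (X i, y0) = Qx (x, y0) * h.
have [xi xiE] : {xi : 'I_N -> R & forall i : 'I_N, xiP i (xi i)}.
  apply: (@choice 'I_N R (fun i => xiP i)) => i; by have [x] := Qi i; exists x.
have QS : \sum_(i < N) Qx (xi i, y0) = 0.
  apply: (mulIf (lt0r_neq0 h0)); rewrite mul0r mulr_suml.
  under eq_bigr => i _ do rewrite -(proj2 (xiE i)).
  rewrite -(big_mkord xpredT (fun i => Q (X i.+1, y0) - Q (X i, y0))).
  rewrite telescope_sumr // X0 XN !Q0 ?subrr ?normrN ?gtr0_norm //.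
    by split=> //=; rewrite normrN gtr0_norm.
  by split=> //=; rewrite gtr0_norm.
(* Each term is negative, its two points being within [d] of each other on one horizontal line, and
   the sum is nonempty since [N] is a successor; yet both partial sums are zero. *)
have : \sum_(i < N) (Qx (xi i, y0) + Py (X i, y0)) < \sum_(i < N) (0 : R).
  apply: ltr_sum => [|i _]; last first.
    have [h1 _] := xiE i.
    apply: (Hd (X i, y0)) => /=; last exact: le_trans hd.
    by split => //=; rewrite Xin // ltnW.
  by rewrite has_predT /index_enum -enumT size_enum_ord.
by rewrite big1_eq big_split /= QS Iy0 addr0 ltxx.
Qed.

(** * Symmetry of mixed partial derivatives *)

(** The second difference is an increment in [s] of the first difference in [t]; the mean value
    theorem is applied once in each variable. *)
Lemma mixed_mvt (R : realType) (f fx fxy : R -> R -> R) (x y h : R) : 0 <= h ->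
  (forall s t, x <= s <= x + h -> y <= t <= y + h ->
    is_derive s 1 (f^~ t) (fx s t)) ->
  (forall s t, x <= s <= x + h -> y <= t <= y + h ->
    is_derive t 1 (fx s) (fxy s t)) ->
  exists s t, [/\ x <= s <= x + h, y <= t <= y + h &
    f (x + h) (y + h) - f (x + h) y - (f x (y + h) - f x y)
    = fxy s t * h * h].
Proof.
move=> h0 fD fxD.
have xh : x <= x + h by lra.
have yh : y <= y + h by lra.
have [s sx|s sx Es] := @mvt_le R (fun s => f s (y + h) - f s y)
    (fun s => fx s (y + h) - fx s y) _ _ xh.
  by apply: is_deriveB; apply: fD; rewrite ?lexx ?yh.
have [t ty|t ty Et] := @mvt_le R (fx s) (fxy s) _ _ yh; first exact: fxD.
by exists s, t; split => //; rewrite Es Et; ring.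
Qed.

(** The second difference over a small square does not depend on the order of the variables, so
    [fxy] at one point of the square equals [fyx] at another. By continuity the two values at [z]
    cannot differ. *)
Lemma schwarz (R : realType) (f fx fy fxy fyx : R * R -> R) (z : R * R) :
  (\forall w \near z, is_pderiv false f w (fx w)) ->
  (\forall w \near z, is_pderiv true f w (fy w)) ->
  (\forall w \near z, is_pderiv true fx w (fxy w)) ->
  (\forall w \near z, is_pderiv false fy w (fyx w)) ->
  {for z, continuous fxy} -> {for z, continuous fyx} -> fxy z = fyx z.
Proof.
move=> Dx Dy Dxy Dyx cxy cyx; apply/eqP; rewrite -subr_eq0; apply/negP => /negP.
rewrite -normr_gt0 => e0; pose e := `|fxy z - fyx z| / 2.
have {}e0 : 0 < e by rewrite divr_gt0.
have /cvgr_dist_lt/(_ _ e0) Cxy := cxy; have /cvgr_dist_lt/(_ _ e0) Cyx := cyx.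
have : \forall w \near z, [/\ is_pderiv false f w (fx w),
    is_pderiv true f w (fy w), is_pderiv true fx w (fxy w),
    is_pderiv false fy w (fyx w) &
    `|fxy z - fxy w| < e /\ `|fyx z - fyx w| < e].
  by near=> w; split; [| | | |split]; near: w.
move=> /nbhs_ballP[d /= d0 Hd].
pose h := d / 2; have h0 : 0 < h by rewrite divr_gt0.
have inb s t : z.1 <= s <= z.1 + h -> z.2 <= t <= z.2 + h -> ball z d (s, t).
  move=> sz tz; have dh : d = 2 * h by rewrite /h; field.
  by split; rewrite /ball /= ler0_norm; lra.
have [|||s [t [sz tz E]]] := @mixed_mvt R (fun s t => f (s, t))
  (fun s t => fx (s, t)) (fun s t => fxy (s, t)) z.1 z.2 h; first exact: ltW.
- by move=> s t sz tz; have [+ _ _ _ _] := Hd _ (inb s t sz tz).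
- by move=> s t sz tz; have [_ _ + _ _] := Hd _ (inb s t sz tz).
have [|||t' [s' [tz' sz' E']]] := @mixed_mvt R (fun t s => f (s, t))
  (fun t s => fy (s, t)) (fun t s => fyx (s, t)) z.2 z.1 h; first exact: ltW.
- by move=> t' s' tz' sz'; have [_ + _ _ _] := Hd _ (inb s' t' sz' tz').
- by move=> t' s' tz' sz'; have [_ _ _ + _] := Hd _ (inb s' t' sz' tz').
have EE : fxy (s, t) = fyx (s', t').
  have hh : h != 0 by rewrite gt_eqF.
  apply: (mulIf hh); apply: (mulIf hh); rewrite -E -E'; ring.
have [_ _ _ _ [H1 _]] := Hd _ (inb _ _ sz tz).
have [_ _ _ _ [_ H2]] := Hd _ (inb _ _ sz' tz').
have : `|fxy z - fyx z| < e + e.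
  have -> : fxy z - fyx z = (fxy z - fxy (s, t)) - (fyx z - fyx (s', t')).
    by rewrite EE; ring.
  exact: le_lt_trans (ler_normB _ _) (ltrD H1 H2).
by rewrite /e -splitr ltxx.
Unshelve. all: by end_near. Qed.

(** * Rules for partial derivatives and composition with bumps *)

Lemma line_coord (R : realType) (i : bool) (z : R * R) :
  line i z (coord i z) = z.
Proof. by case: i z => -[]. Qed.

Lemma is_pderivB (R : realType) (i : bool) (F G : R * R -> R) (z : R * R)
    (l m : R) : is_pderiv i F z l -> is_pderiv i G z m ->
  is_pderiv i (fun w => F w - G w) z (l - m).
Proof. exact: is_deriveB. Qed.

Lemma is_pderivD (R : realType) (i : bool) (F G : R * R -> R) (z : R * R)
    (l m : R) : is_pderiv i F z l -> is_pderiv i G z m ->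
  is_pderiv i (fun w => F w + G w) z (l + m).
Proof. exact: is_deriveD. Qed.

Lemma is_pderivM (R : realType) (i : bool) (F G : R * R -> R) (z : R * R)
    (l m : R) : is_pderiv i F z l -> is_pderiv i G z m ->
  is_pderiv i (fun w => F w * G w) z (l * G z + F z * m).
Proof.
move=> FD GD; apply: is_derive_eq (is_deriveM FD GD) _.
by rewrite /GRing.scale /= line_coord; ring.
Qed.

Lemma is_pderiv_comp (R : realType) (i : bool) (A : R -> R) (F : R * R -> R)
    (z : R * R) (k l : R) : is_derive (F z) 1 A k -> is_pderiv i F z l ->
  is_pderiv i (A \o F) z (k * l).
Proof.
by move=> AD FD; apply: is_derive1_comp FD; rewrite /= line_coord.
Qed.

(* [D] is the gradient of [F], and [M] is both of its mixed second partials. *)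
Record C2 (R : realType) (K : set (R * R)) (F : R * R -> R)
    (D : bool -> R * R -> R) (M : R * R -> R) : Prop := C2Def {
  C2_cont : forall z, K z -> {for z, continuous F};
  C2_cont1 : forall i z, K z -> {for z, continuous (D i)};
  C2_contM : forall z, K z -> {for z, continuous M};
  C2_pderiv : forall i z, K z -> is_pderiv i F z (D i z);
  C2_mixed : forall i z, K z -> is_pderiv i (D (~~ i)) z (M z) }.

Lemma C2_subset (R : realType) (K L : set (R * R)) (F : R * R -> R)
    (D : bool -> R * R -> R) (M : R * R -> R) :
  L `<=` K -> C2 K F D M -> C2 L F D M.
Proof. by move=> LK [? ? ? ? ?]; split; auto. Qed.

(** The product rule gives the same mixed partial in either order, as its formula is symmetric in
    the two directions; continuity of [b] makes it continuous. *)
Lemma C2_bump (R : realType) (K : set (R * R)) (F : R * R -> R)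
    (D : bool -> R * R -> R) (M : R * R -> R) (w c : R) (A a b : R -> R) :
  bump w c A a b -> C2 K F D M ->
  C2 K (A \o F) (fun i z => a (F z) * D i z)
    (fun z => b (F z) * D false z * D true z + a (F z) * M z).
Proof.
move=> [AD aD bC _ _ _ _ _ _] [Fc Dc Mc FD DM].
have Ac u : {for u, continuous A} by exact: is_derive_continuous (AD u).
have ac u : {for u, continuous a} by exact: is_derive_continuous (aD u).
have aFc z : K z -> {for z, continuous (a \o F)}.
  by move=> Kz; apply: continuous_comp; [exact: Fc | exact: ac].
have bFc z : K z -> {for z, continuous (b \o F)}.
  by move=> Kz; apply: continuous_comp; [exact: Fc | exact: bC].
split=> [z Kz|i z Kz|z Kz|i z Kz|i z Kz].
- by apply: continuous_comp; [exact: Fc | exact: Ac].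
- by apply: cvgM; [exact: aFc | exact: Dc].
- apply: cvgD; apply: cvgM; [|exact: Dc|exact: aFc|exact: Mc].
  by apply: cvgM; [exact: bFc|exact: Dc].
- exact: is_pderiv_comp (AD _) (FD i z Kz).
- apply: is_derive_eq (is_pderivM (is_pderiv_comp (aD _) (FD i z Kz))
    (DM i z Kz)) _.
  by case: i; rewrite /=; ring.
Qed.

(** The directional and the one-variable difference quotients are the same function of [h]. *)
Lemma is_pderiv_partial (R : realType) (i : bool) (F : R * R -> R)
    (z : R * R) : derivable F z (axis R i) -> is_pderiv i F z (partial i F z).
Proof.
have E : (fun h : R => h^-1 *: (((F \o line i z) \o shift (coord i z)) (h *: 1)
      - (F \o line i z) (coord i z))) =
    (fun h : R => h^-1 *: ((F \o shift z) (h *: axis R i) - F z)).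
  apply/funext => h; rewrite /= line_coord.
  congr (_ *: (F _ - _)); rewrite /shift.
  case: i => /=; rewrite [RHS]surjective_pairing; congr (_, _);
    by rewrite -[LHS]add0r -[X in X + _](mulr0 h).
move=> FD; split; first by rewrite /derivable E.
by rewrite /derive E.
Qed.

(** Openness of [V] supplies the derivatives near each point, as [schwarz] requires to identify the
    two mixed partials. *)
Lemma smooth_C2 (R : realType) (V : set (R * R)) (F : R * R -> R) :
  open V -> smooth_on V F ->
  C2 V F (fun i => partial i F) (partial true (partial false F)).
Proof.
move=> Vo FS.
have near_V (P : R * R -> Prop) z : V z -> (forall w, V w -> P w) ->
    \forall w \near z, P w.
  by move=> Vz VP; apply: filterS (open_nbhs_nbhs (conj Vo Vz)).
have D0 i w : V w -> is_pderiv i F w (partial i F w).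
  by move=> Vw; apply: is_pderiv_partial; have [_] := FS [::] w Vw; exact.
have D1 i j w : V w ->
    is_pderiv i (partial j F) w (partial i (partial j F) w).
  by move=> Vw; apply: is_pderiv_partial; have [_] := FS [:: j] w Vw; exact.
split=> [z /(FS [::])[]//|i z /(FS [:: i])[]//|||].
- by move=> z /(FS [:: true; false])[].
- exact: D0.
- move=> [] z Vz; first exact: D1 true false z Vz.
  apply: is_derive_eq (D1 false true z Vz) _; apply/esym.
  have [cxy _] := FS [:: true; false] z Vz.
  have [cyx _] := FS [:: false; true] z Vz.
  exact: (schwarz (near_V _ z Vz (D0 false)) (near_V _ z Vz (D0 true))
    (near_V _ z Vz (D1 true false)) (near_V _ z Vz (D1 false true)) cxy cyx).
Qed.

(** * Comparison of Jacobians through a field vanishing on the boundary *)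

(** For gradients [D] and [E] this is the opposite of the Poisson bracket. *)
Definition jacobian (R : realType) (D E : bool -> R * R -> R) (z : R * R) : R :=
  D false z * E true z - D true z * E false z.

(* The 1-form [(F - F0) dG0 - (G - G0) dF] vanishes on the boundary, and its
   differential is the difference of the two Jacobians. The terms in [theta]
   come from an explicit field vanishing on the boundary, whose divergence
   [a(x) a(y) - m ^ 2] is negative away from the small square of size [s]. *)
Lemma jacobian_compare (R : realType) (r s theta : R) (A a b : R -> R)
    (F G F0 G0 : R * R -> R) (DF DG DF0 DG0 : bool -> R * R -> R)
    (MF MG MF0 MG0 : R * R -> R) :
  0 < s <= r -> bump 0 s A a b ->
  C2 (square r) F DF MF -> C2 (square r) G DG MG ->
  C2 (square r) F0 DF0 MF0 -> C2 (square r) G0 DG0 MG0 ->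
  (forall z, square r z -> `|z.1| = r \/ `|z.2| = r ->
    (F z = F0 z /\ forall i, DF i z = 0) \/
    (G z = G0 z /\ forall i, DG0 i z = 0)) ->
  exists2 z, square r z &
    0 <= jacobian DF0 DG0 z - jacobian DF DG z
         + theta * (a z.1 * a z.2 - (8 / 15 * s / r) ^+ 2).
Proof.
move=> /andP[s0 sr] [AD aD _ _ _ _ _ Ar Al] [Fc DFc MFc FD DFD]
  [Gc DGc MGc GD DGD] [F0c DF0c MF0c F0D DF0D] [G0c DG0c MG0c G0D DG0D] bd.
have r0 : 0 < r by lra.
pose m := 8 / 15 * s / r.
(* As [A] takes the values 8 / 15 * s and its opposite at [r] and [- r], the slope [m] makes [al]
   vanish at both ends. *)
pose al x := A x - m * x.
have al0 x : `|x| = r -> al x = 0.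
  have mr : m * r = 8 / 15 * s by rewrite /m; field; lra.
  rewrite /al; case: (leP 0 x) => x0;
    rewrite ?(ger0_norm x0) ?(ltr0_norm x0) => xr.
    by rewrite Ar xr ?mr ?subrr // add0r.
  have -> : x = - r by lra.
  by rewrite Al ?mulrN ?mr ?subrr // sub0r; lra.
have alD (x : R) : is_derive x 1 al (a x - m).
  apply: is_derive_eq; rewrite /GRing.scale /=; ring.
have ac u : {for u, continuous a} by exact: is_derive_continuous (aD u).
have a1c z : {for z, continuous (fun z : R * R => a z.1)}.
  by apply: continuous_comp; [exact: cvg_fst|exact: ac].
have a2c z : {for z, continuous (fun z : R * R => a z.2)}.
  by apply: continuous_comp; [exact: cvg_snd|exact: ac].
(* Up to the [theta] terms, [P] is the dx coefficient of the 1-form and [Q] is minus its dy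
   coefficient. The explicit field is [theta] times (al(x) a(y), m al(y)). *)
pose Q z := (G z - G0 z) * DF true z - (F z - F0 z) * DG0 true z
  + theta * (al z.1 * a z.2).
pose P z := (F z - F0 z) * DG0 false z - (G z - G0 z) * DF false z
  + theta * m * al z.2.
(* The terms in [MF] and [MG0] cancel in [Qx + Py]. *)
pose Qx z := ((DG false z - DG0 false z) * DF true z + (G z - G0 z) * MF z)
  - ((DF false z - DF0 false z) * DG0 true z + (F z - F0 z) * MG0 z)
  + theta * ((a z.1 - m) * a z.2).
pose Py z := ((DF true z - DF0 true z) * DG0 false z + (F z - F0 z) * MG0 z)
  - ((DG true z - DG0 true z) * DF false z + (G z - G0 z) * MF z)
  + theta * m * (a z.2 - m).
(* Pairing [F - F0] with [DG0] and [G - G0] with [DF] lets either boundary alternative kill both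
   products. *)
have bd0 z : square r z -> `|z.1| = r \/ `|z.2| = r -> forall i j,
    (F z - F0 z) * DG0 i z = 0 /\ (G z - G0 z) * DF j z = 0.
  move=> sz zr i j; have [[-> E]|[-> E]] := bd z sz zr.
    by rewrite E subrr mul0r mulr0.
  by rewrite E subrr mul0r mulr0.
have [||||||z sz zE] := @divergence_ge0 R r P Q Py Qx r0.
- move=> z sz; apply: is_pderivD.
    apply: is_pderivB; apply: is_pderivM; try apply: is_pderivB.
    + exact: GD.
    + exact: G0D.
    + exact: (DFD false).
    + exact: FD.
    + exact: F0D.
    + exact: (DG0D false).
  apply: is_derive_eq (is_deriveM (is_derive_cst theta _ _)
    (is_deriveM (alD z.1) (is_derive_cst (a z.2) _ _))) _.
  rewrite /GRing.scale /=; ring.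
- move=> z sz; apply: is_pderivD.
    apply: is_pderivB; apply: is_pderivM; try apply: is_pderivB.
    + exact: FD.
    + exact: F0D.
    + exact: (DG0D true).
    + exact: GD.
    + exact: G0D.
    + exact: (DFD true).
  apply: is_derive_eq (is_deriveM (is_derive_cst (theta * m) _ _) (alD z.2)) _.
  rewrite /GRing.scale /=; ring.
- move=> z sz; apply: cvgD.
    by apply: cvgB; apply: cvgD; apply: cvgM; try apply: cvgB;
      first [exact: Fc | exact: Gc | exact: F0c | exact: G0c | exact: DFc
        | exact: DGc | exact: DF0c | exact: DG0c | exact: MFc | exact: MG0c].
  apply: cvgM; first exact: cvg_cst.
  by apply: cvgM; [apply: cvgB; [exact: a1c|exact: cvg_cst]|exact: a2c].
- move=> z sz; apply: cvgD.
    by apply: cvgB; apply: cvgD; apply: cvgM; try apply: cvgB;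
      first [exact: Fc | exact: Gc | exact: F0c | exact: G0c | exact: DFc
        | exact: DGc | exact: DF0c | exact: DG0c | exact: MFc | exact: MG0c].
  apply: cvgM; first exact: cvg_cst.
  by apply: cvgB; [exact: a2c|exact: cvg_cst].
- move=> z sz zr; have [E1 E2] := bd0 z sz (or_introl zr) true true.
  by rewrite /Q E1 E2 al0 // mul0r mulr0 subr0 addr0.
- move=> z sz zr; have [E1 E2] := bd0 z sz (or_intror zr) false false.
  by rewrite /P E1 E2 al0 // mulr0 subr0 addr0.
- exists z => //; move: zE; rewrite -/m.
  have -> // : Qx z + Py z = jacobian DF0 DG0 z - jacobian DF DG z
         + theta * (a z.1 * a z.2 - m ^+ 2).
  rewrite /Qx /Py /jacobian; ring.
Qed.

(** * Quantitative injectivity near the origin *)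

Lemma square_origin (R : realType) (r x : R) : `|x| <= r ->
  [/\ square r (x, 0), square r (0, x) & 0 <= r].
Proof.
by move=> xr; have r0 := le_trans (normr_ge0 x) xr; rewrite /square /= normr0.
Qed.

(** Mean value theorem on the two legs of the path from the origin through (0, y). Each leg has its
    own intermediate point. *)
Lemma increment (R : realType) (r : R) (F : R * R -> R)
    (D : bool -> R * R -> R) (z : R * R) :
  (forall i w, square r w -> is_pderiv i F w (D i w)) -> square r z ->
  exists w v, [/\ square r w, square r v &
    F z - F (0, 0) = D false w * z.1 + D true v * z.2].
Proof.
case: z => x y FD [/= xr yr].
have [s|s sx Es] := @mvt_dist R (fun s => F (s, y))
    (fun s => D false (s, y)) 0 x.
  rewrite !subr0 => sx; apply: (FD false (s, y)).
  by split => //=; exact: le_trans xr.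
have [t|t ty Et] := @mvt_dist R (fun t => F (0, t))
    (fun t => D true (0, t)) 0 y.
  rewrite !subr0 => ty; apply: (FD true (0, t)).
  by have [] := square_origin (le_trans ty yr).
rewrite !subr0 in sx ty Es Et.
exists (s, y), (0, t); split.
- by split => //=; exact: le_trans xr.
- by have [] := square_origin (le_trans ty yr).
- by rewrite -Es -Et; ring.
Qed.

(** Cramer's rule, the determinant being at least 1 / 2 in absolute value. *)
Lemma det2_bound (R : realFieldType) (p q s t x y K c : R) :
  `|p| <= K -> `|q| <= K -> `|s| <= K -> `|t| <= K ->
  1 / 2 <= `|p * t - q * s| ->
  `|p * x + q * y| <= c -> `|s * x + t * y| <= c ->
  `|x| <= 4 * K * c /\ `|y| <= 4 * K * c.
Proof.
move=> pK qK sK tK det uc vc.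
have bnd a b u v : `|a| <= K -> `|b| <= K -> `|u| <= c -> `|v| <= c ->
    `|a * u - b * v| <= 2 * K * c.
  move=> aK bK ua va; apply: le_trans (ler_normB _ _) _; rewrite !normrM.
  have -> : 2 * K * c = K * c + K * c by ring.
  by apply: lerD; apply: ler_pM.
have half u : `|(p * t - q * s) * u| <= 2 * K * c -> `|u| <= 4 * K * c.
  rewrite normrM => H; have := normr_ge0 u; nra.
split; apply: half.
  have -> : (p * t - q * s) * x = t * (p * x + q * y) - q * (s * x + t * y).
    by ring.
  exact: bnd.
have -> : (p * t - q * s) * y = p * (s * x + t * y) - s * (p * x + q * y).
  by ring.
exact: bnd.
Qed.

Lemma det2_perturb (R : realFieldType) (p q s t p' q' s' t' K d : R) :
  `|p| <= K -> `|q| <= K -> `|s'| <= K -> `|t'| <= K ->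
  `|p - p'| <= d -> `|q - q'| <= d -> `|s - s'| <= d -> `|t - t'| <= d ->
  `|(p * t - q * s) - (p' * t' - q' * s')| <= 4 * K * d.
Proof.
move=> pK qK sK tK pd qd sd td.
have -> : (p * t - q * s) - (p' * t' - q' * s') =
  (p * (t - t') + (p - p') * t') - (q * (s - s') + (q - q') * s') by ring.
have -> : 4 * K * d = (K * d + d * K) + (K * d + d * K) by ring.
apply: le_trans (ler_normB _ _) _.
by apply: lerD; apply: le_trans (ler_normD _ _) _; rewrite !normrM;
  apply: lerD; apply: ler_pM.
Qed.

(** The increments of [F] and [G] are the image of [z] under a matrix close to the Jacobian matrix
    at 0, hence invertible. Were both increments small, Cramer's rule would put [z] in the square of
    size [r / 2]. *)
Lemma boundary_separation (R : realType) (V : set (R * R)) (F G : R * R -> R)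
    (DF DG : bool -> R * R -> R) (MF MG : R * R -> R) :
  open V -> V (0, 0) -> C2 V F DF MF -> C2 V G DG MG ->
  jacobian DF DG (0, 0) = -1 ->
  exists2 d, 0 < d & forall r, 0 < r < d -> exists2 c, 0 < c &
    forall z, square r z -> `|z.1| = r \/ `|z.2| = r ->
      2 * c <= `|F z - F (0, 0)| \/ 2 * c <= `|G z - G (0, 0)|.
Proof.
move=> Vo V0 [_ DFc _ FD _] [_ DGc _ GD _] J.
(* The entries at 0 are at most [K - 1]; the spare 1 absorbs a perturbation by [e <= 1]. *)
pose K := 1 + \sum_(i : bool) (`|DF i (0, 0)| + `|DG i (0, 0)|).
pose e := (8 * K)^-1.
have KE : K = 1 + ((`|DF true (0, 0)| + `|DG true (0, 0)|)
    + (`|DF false (0, 0)| + `|DG false (0, 0)|)) by rewrite /K big_bool.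
have K1 : 1 <= K.
  by rewrite KE lerDl !addr_ge0.
have K0 : 0 < K by lra.
have e0 : 0 < e by rewrite invr_gt0; lra.
have Ke : 4 * K * e = 1 / 2 by rewrite /e; field; lra.
have e1 : e <= 1 by nra.
have Dn i : `|DF i (0, 0)| <= K - 1 /\ `|DG i (0, 0)| <= K - 1.
  have := normr_ge0 (DF true (0, 0)); have := normr_ge0 (DF false (0, 0)).
  have := normr_ge0 (DG true (0, 0)); have := normr_ge0 (DG false (0, 0)).
  by rewrite KE; case: i; split; lra.
have Fnear i : \forall z \near ((0, 0) : R * R), `|DF i (0, 0) - DF i z| <= e.
  by have /cvgr_dist_le/(_ _ e0) := DFc i _ V0.
have Gnear i : \forall z \near ((0, 0) : R * R), `|DG i (0, 0) - DG i z| <= e.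
  by have /cvgr_dist_le/(_ _ e0) := DGc i _ V0.
have Vnear : \forall z \near ((0, 0) : R * R), V z.
  exact: (open_nbhs_nbhs (conj Vo V0)).
have : \forall z \near ((0, 0) : R * R), V z /\
    forall i, `|DF i (0, 0) - DF i z| <= e /\ `|DG i (0, 0) - DG i z| <= e.
  near=> z; split; first by near: z.
  by case; split; near: z;
    [exact: Fnear|exact: Gnear|exact: Fnear|exact: Gnear].
move=> /nbhs_ballP[d /= d0 Hd].
(* Chosen so that the Cramer bound [4 * K * (2 * c)] is [r / 2]. *)
exists d => // r /andP[r0 rd]; exists (r / (16 * K)).
  by rewrite divr_gt0 //; lra.
have inb z : square r z -> ball ((0, 0) : R * R) d z.
  by move=> [z1 z2]; split; rewrite /ball /= sub0r normrN;
    apply: le_lt_trans rd.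
have near_e i z : square r z ->
    `|DF i (0, 0) - DF i z| <= e /\ `|DG i (0, 0) - DG i z| <= e.
  by move=> /inb/Hd[].
have near_K i z : square r z -> `|DF i z| <= K /\ `|DG i z| <= K.
  move=> sz; have [h1 h2] := near_e i z sz; have [k1 k2] := Dn i.
  have := ler_normB (DF i (0, 0)) (DF i (0, 0) - DF i z).
  have := ler_normB (DG i (0, 0)) (DG i (0, 0) - DG i z).
  by rewrite !subKr; split; lra.
move=> z sz zr.
have [w1 [w2 [sw1 sw2 EF]]] := increment
  (fun i w sw => FD i w (proj1 (Hd _ (inb w sw)))) sz.
have [w3 [w4 [sw3 sw4 EG]]] := increment
  (fun i w sw => GD i w (proj1 (Hd _ (inb w sw)))) sz.
case: (leP (2 * (r / (16 * K))) `|F z - F (0, 0)|) => hF; first by left.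
case: (leP (2 * (r / (16 * K))) `|G z - G (0, 0)|) => hG; first by right.
exfalso.
have K' i : `|DF i (0, 0)| <= K /\ `|DG i (0, 0)| <= K.
  by have [] := Dn i; split; lra.
(* The entries are taken at four different points; the determinant moves by at most
   [4 * K * e = 1 / 2] from its value -1 at 0. *)
have det : 1 / 2 <= `|DF false w1 * DG true w4 - DF true w2 * DG false w3|.
  have := @det2_perturb _ (DF false (0, 0)) (DF true (0, 0)) (DG false (0, 0))
    (DG true (0, 0)) (DF false w1) (DF true w2) (DG false w3) (DG true w4) K e
    (proj1 (K' _)) (proj1 (K' _)) (proj2 (near_K _ _ sw3))
    (proj2 (near_K _ _ sw4)) (proj1 (near_e _ _ sw1)) (proj1 (near_e _ _ sw2))
    (proj2 (near_e _ _ sw3)) (proj2 (near_e _ _ sw4)).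
  rewrite -/(jacobian DF DG (0, 0)) J Ke => h.
  move: (DF false w1 * _ - _) h => D h.
  by have := ler_normD (-1 - D) D; rewrite subrK normrN1; lra.
rewrite EF in hF; rewrite EG in hG.
have [h1 h2] := det2_bound (proj1 (near_K _ _ sw1)) (proj1 (near_K _ _ sw2))
  (proj2 (near_K _ _ sw3)) (proj2 (near_K _ _ sw4)) det (ltW hF) (ltW hG).
have E : 4 * K * (2 * (r / (16 * K))) = r / 2 by field; lra.
by rewrite E in h1 h2; case: zr => zr; rewrite zr in h1 h2; lra.
Unshelve. all: by end_near. Qed.

(** * The bracket under uniform perturbation *)

Lemma supnorm_lt (R : realType) (A : set (R * R)) (f : R * R -> R) (d : R) :
  (supnorm A f < d%:E)%E -> forall z, A z -> `|f z| < d.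
Proof.
move=> fd z Az; rewrite -lte_fin; apply: le_lt_trans fd.
by apply: ereal_sup_ubound; exists z.
Qed.

Lemma poisson_jacobian (R : realType) (F G : R * R -> R) (z : R * R) :
  poisson F G z = - jacobian (fun i => partial i F) (fun i => partial i G) z.
Proof. by []. Qed.

(** Both points lie outside the bump and on the same side of it, where [A] is constant. *)
Lemma bump_eq (R : realType) (w c : R) (A a b : R -> R) (u v d : R) :
  0 < c -> bump w c A a b -> `|u - v| < d -> d <= c -> 2 * c <= `|v - w| ->
  [/\ A u = A v, a u = 0 & a v = 0].
Proof.
move=> c0 B uv dc; rewrite ler_normr => vw.
have {}uv : - c < u - v < c by rewrite -ltr_norml (lt_le_trans uv).
case/orP: vw => vw; split.
- by rewrite !(bump_right B) //; lra.
- by apply: (bump_out B); rewrite ler_normr; apply/orP; left; lra.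
- by apply: (bump_out B); rewrite ler_normr; apply/orP; left; lra.
- by rewrite !(bump_left B) //; lra.
- by apply: (bump_out B); rewrite ler_normr; apply/orP; right; lra.
- by apply: (bump_out B); rewrite ler_normr; apply/orP; right; lra.
Qed.

Lemma open_square (R : realType) (P : R * R -> Prop) :
  (\forall z \near ((0, 0) : R * R), P z) ->
  exists2 d, 0 < d & forall r, r < d -> forall z, square r z -> P z.
Proof.
move=> /nbhs_ballP[d /= d0 Hd]; exists d => // r rd z [z1 z2]; apply: Hd.
by split; rewrite /ball /= sub0r normrN; apply: le_lt_trans rd.
Qed.

Theorem proposition3p2 (R : realType) (V : set (R * R))
    (V_open : open V) (V_0 : V (0, 0)) (F0 G0 : R * R -> R)
    (F0_smooth : smooth_closure V F0) (G0_smooth : smooth_closure V G0)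
    (FG0 : poisson F0 G0 (0, 0) = 1) :
  forall eps : R, 0 < eps ->
  exists (delta : R) (U : set (R * R)),
    [/\ 0 < delta, open U, U (0, 0), U `<=` V &
     forall F G : R * R -> R, smooth_closure V F -> smooth_closure V G ->
       (supnorm (closure V) (fun z => F z - F0 z)%R < delta%:E)%E ->
       (supnorm (closure V) (fun z => G z - G0 z)%R < delta%:E)%E ->
       exists2 z : R * R, U z & poisson F G z > 1 - eps].
Proof.
move=> eps eps0.
have C2F0 : C2 V F0 (fun i => partial i F0) (partial true (partial false F0)).
  by apply: smooth_C2 => //; case: F0_smooth.
have C2G0 : C2 V G0 (fun i => partial i G0) (partial true (partial false G0)).
  by apply: smooth_C2 => //; case: G0_smooth.
have J0 : jacobian (fun i => partial i F0) (fun i => partial i G0) (0, 0) = -1.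
  by rewrite -FG0 poisson_jacobian opprK.
have [d1 d10 Hd1] := boundary_separation V_open V_0 C2F0 C2G0 J0.
have pc : {for ((0, 0) : R * R), continuous (poisson F0 G0)}.
  have cF i : {for ((0, 0) : R * R), continuous (partial i F0)}.
    exact: (C2_cont1 C2F0).
  have cG i : {for ((0, 0) : R * R), continuous (partial i G0)}.
    exact: (C2_cont1 C2G0).
  by apply: cvgN; apply: cvgB; apply: cvgM;
    [exact: cF | exact: cG | exact: cF | exact: cG].
have Vnear : \forall z \near ((0, 0) : R * R), V z.
  exact: (open_nbhs_nbhs (conj V_open V_0)).
have pnear : \forall z \near ((0, 0) : R * R), 1 - eps / 2 < poisson F0 G0 z.
  by apply: (cvgr_gt _ pc); rewrite FG0; lra.
have [d2 d20 Hd2] : exists2 d, 0 < d & forall r, r < d -> forall z,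
    square r z -> V z /\ 1 - eps / 2 < poisson F0 G0 z.
  by apply: open_square; near=> z; split; near: z.
pose r := Num.min d1 d2 / 2.
have d0 : 0 < Num.min d1 d2 by rewrite lt_min d10.
have r0 : 0 < r by rewrite divr_gt0.
have rmin : r < Num.min d1 d2 by rewrite /r; lra.
have [rd1 rd2] : r < d1 /\ r < d2 by move: rmin; rewrite lt_min => /andP[].
have rV z : square r z -> V z by move=> sz; have [] := Hd2 r rd2 z sz.
have [|c c0 sep] := Hd1 r; first by rewrite r0.
have c20 : 0 < c / 2 by rewrite divr_gt0.
have Fnear : \forall z \near ((0, 0) : R * R), `|F0 (0, 0) - F0 z| <= c / 2.
  by have /cvgr_dist_le/(_ _ c20) := C2_cont C2F0 V_0.
have Gnear : \forall z \near ((0, 0) : R * R), `|G0 (0, 0) - G0 z| <= c / 2.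
  by have /cvgr_dist_le/(_ _ c20) := C2_cont C2G0 V_0.
have [d3 d30 Hd3] : exists2 d, 0 < d & forall r, r < d -> forall z,
    square r z -> `|F0 (0, 0) - F0 z| <= c / 2 /\ `|G0 (0, 0) - G0 z| <= c / 2.
  by apply: open_square; near=> z; split; near: z.
(* On the square of size [s], [F0] and [G0] stay within [c / 2] of their values at 0, so both bumps
   are at least 1 / 2 there. *)
pose s := Num.min r (d3 / 2).
have s0 : 0 < s by rewrite lt_min r0 divr_gt0.
have sr : s <= r by rewrite ge_min lexx.
have sd3 : s < d3.
  by apply: (@le_lt_trans _ _ (d3 / 2)); [rewrite ge_min lexx orbT|lra].
have [A [a [b Bs]]] := @bump_exists R 0 s s0.
have [AF [aF [bF BF]]] := @bump_exists R (F0 (0, 0)) c c0.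
have [AG [aG [bG BG]]] := @bump_exists R (G0 (0, 0)) c c0.
(* At most [eps / 2] times 1 / 4, the lower bound of the product of bumps on the small square. *)
pose theta := eps / 8.
have theta0 : 0 < theta by rewrite divr_gt0.
pose m2 := (8 / 15 * s / r) ^+ 2.
have m20 : 0 < m2 by rewrite exprn_gt0 // divr_gt0 ?mulr_gt0 // divr_gt0.
(* Here [1 + eps] bounds the absolute value of [1 - eps], and [8 / c] is the sum of the Lipschitz
   constants of the two bumps. *)
pose L := (1 + eps) * (8 / c).
have L0 : 0 < L by rewrite mulr_gt0 ?divr_gt0 ?addr_gt0.
(* The bound [c] serves on the boundary; the other one keeps the error from the bumps below half of
   the gain [theta * m2]. *)
pose delta := Num.min c (theta * m2 / (2 * L)).
have delta0 : 0 < delta.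
  rewrite lt_min c0 /=; apply: divr_gt0; exact: mulr_gt0.
have delta_c : delta <= c by rewrite ge_min lexx.
have delta_L : L * delta <= theta * m2 / 2.
  have : delta <= theta * m2 / (2 * L) by rewrite ge_min lexx orbT.
  have L20 : 0 < 2 * L by exact: mulr_gt0.
  rewrite ler_pdivlMr // => h; lra.
exists delta, (V `&` ball ((0, 0) : R * R) d2); split => //.
- by apply: openI => //; exact: ball_open.
- by split => //; exact: ballxx.
move=> F G [F_smooth _ _] [G_smooth _ _] /supnorm_lt FF0 /supnorm_lt GG0.
apply: contrapT => noz.
have Ple z : square r z -> poisson F G z <= 1 - eps.
  move=> sz; rewrite leNgt; apply/negP => h; apply: noz; exists z => //.
  split; first exact: rV.
  case: sz => z1 z2.
  by split; rewrite /ball /= sub0r normrN; apply: le_lt_trans rd2.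
have {}FF0 z : square r z -> `|F z - F0 z| < delta.
  by move=> /rV Vz; apply: FF0; exact: subset_closure.
have {}GG0 z : square r z -> `|G z - G0 z| < delta.
  by move=> /rV Vz; apply: GG0; exact: subset_closure.
have C2F := C2_bump BF (C2_subset rV (smooth_C2 V_open F_smooth)).
have C2G := C2_bump BG (C2_subset rV (smooth_C2 V_open G_smooth)).
have {}C2F0 := C2_bump BF (C2_subset rV C2F0).
have {}C2G0 := C2_bump BG (C2_subset rV C2G0).
have srr : 0 < s <= r by rewrite s0.
(* On the boundary one of [F0], [G0] is at least [2 * c] from its value at 0, so the matching
   composites agree and their gradients vanish. *)
have [z sz zr|z sz] := jacobian_compare theta srr Bs C2F C2G C2F0 C2G0.
  have [hF|hG] := sep z sz zr.
    have [E1 E2 _] := bump_eq c0 BF (FF0 z sz) delta_c hF.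
    by left; split => //= i; rewrite E2 mul0r.
  have [E1 _ E2] := bump_eq c0 BG (GG0 z sz) delta_c hG.
  by right; split => //= i; rewrite E2 mul0r.
rewrite -/m2.
have jacE (F1 G1 : R * R -> R) :
    jacobian (fun i z => aF (F1 z) * partial i F1 z)
    (fun i z => aG (G1 z) * partial i G1 z) z
    = - (aF (F1 z) * aG (G1 z) * poisson F1 G1 z).
  by rewrite poisson_jacobian /jacobian; ring.
rewrite !jacE.
have /andP[f0 f1] := bump_itv BF (F z); have /andP[g0 g1] := bump_itv BG (G z).
have /andP[f00 f01] := bump_itv BF (F0 z).
have /andP[g00 g01] := bump_itv BG (G0 z).
set phi := aF (F z) * aG (G z); set phi0 := aF (F0 z) * aG (G0 z).
have phi_ge0 : 0 <= phi by rewrite mulr_ge0.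
have phi0_ge0 : 0 <= phi0 by rewrite mulr_ge0.
have dphi : `|phi - phi0| <= 8 / c * delta.
  have -> : phi - phi0 = aF (F z) * (aG (G z) - aG (G0 z))
      + (aF (F z) - aF (F0 z)) * aG (G0 z) by rewrite /phi /phi0; ring.
  have c4 : 0 < 4 / c by rewrite divr_gt0.
  have lF : `|aF (F z) - aF (F0 z)| <= 4 / c * delta.
    apply: le_trans (bump_lip BF _ _) _.
    by rewrite ler_pM2l // ltW // FF0.
  have lG : `|aG (G z) - aG (G0 z)| <= 4 / c * delta.
    apply: le_trans (bump_lip BG _ _) _.
    by rewrite ler_pM2l // ltW // GG0.
  have -> : 8 / c * delta = 1 * (4 / c * delta) + (4 / c * delta) * 1 by ring.
  apply: le_trans (ler_normD _ _) _; rewrite !normrM.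
  by apply: lerD; apply: ler_pM => //; rewrite ger0_norm.
have P1 : phi * poisson F G z <= phi * (1 - eps) by rewrite ler_wpM2l ?Ple.
have P2 : phi0 * (1 - eps / 2) <= phi0 * poisson F0 G0 z.
  by rewrite ler_wpM2l // ltW //; have [] := Hd2 r rd2 z sz.
have P3 : (1 - eps) * (phi - phi0) <= theta * m2 / 2.
  apply: le_trans delta_L; apply: le_trans (ler_norm _) _.
  rewrite normrM -mulrA; apply: ler_pM => //.
  by apply: le_trans (ler_normB _ _) _; rewrite normr1 gtr0_norm.
have thm : 0 < theta * m2 by rewrite mulr_gt0.
(* Off the small square the left side is 0; on it [phi0] is at least 1 / 4. *)
have P4 : theta * (a z.1 * a z.2) <= eps / 2 * phi0.
  have [z1s|z1s] := leP s `|z.1|.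
    rewrite (bump_out Bs) ?subr0 // mul0r mulr0 mulr_ge0 //; lra.
  have [z2s|z2s] := leP s `|z.2|.
    rewrite (bump_out Bs (u := z.2)) ?subr0 // !mulr0 mulr_ge0 //; lra.
  have [hF hG] := Hd3 s sd3 z (conj (ltW z1s) (ltW z2s)).
  have pF : 1 / 2 <= aF (F0 z) by apply: (bump_in BF); rewrite distrC.
  have pG : 1 / 2 <= aG (G0 z) by apply: (bump_in BG); rewrite distrC.
  have p4 : 1 / 4 <= phi0.
    have -> : 1 / 4 = (1 / 2) * (1 / 2) :> R by field.
    by apply: ler_pM => //; lra.
  have /andP[a10 a11] := bump_itv Bs z.1.
  have /andP[a20 a21] := bump_itv Bs z.2.
  have aa : a z.1 * a z.2 <= 1 by rewrite mulr_ile1.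
  have : eps * (1 / 4) <= eps * phi0 by rewrite ler_pM2l.
  have : theta * (a z.1 * a z.2) <= theta * 1.
    by rewrite ler_pM2l.
  rewrite /theta; lra.
(* By [P1], [P2] and [P4] the nonnegative quantity is at most
   [(1 - eps) * (phi - phi0) - theta * m2], which [P3] makes negative. *)
lra.
Unshelve. all: by end_near. Qed.
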